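(* There is an algorithm that tests whether two given vertices $u,v$ of a simple graph on $n$ vertices are adjacent using $1$ shortest path query, but any algorithm for this problem requires $\Omega(n)$ effective resistance queries.
   Context: The graph is hidden on a known vertex set, unweighted. An effective resistance query on $x,y$ returns $R(x,y)=(\mathbf{1}_x-\mathbf{1}_y)^TL^+(\mathbf{1}_x-\mathbf{1}_y)$, where $L$ is the Laplacian of the graph and $L^+$ its pseudoinverse. A shortest path query on $x,y$ returns the length of a shortest $x$–$y$ path. *)

(* Defs.v *)
From HB Require Import structures.
From mathcomp Require Export all_boot all_order all_algebra.
From mathcomp Require Export all_classical all_reals all_analysis.

Set Implicit Arguments.
Unset Strict Implicit.
Unset Printing Implicit Defensive.

Import Order.TTheory GRing.Theory Num.Theory.
Local Open Scope classical_set_scope.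
Local Open Scope ring_scope.

Record sgraph (V : finType) := SGraph {
  adj : rel V;
  adj_sym : symmetric adj;
  adj_irr : irreflexive adj }.

Section ShortestPath.
Variables (V : finType) (G : sgraph V).

(* [p] lists the vertices after [x], so its size is the number of edges. *)
Definition path_of_length (x y : V) (k : nat) : bool :=
  [exists p : k.-tuple V,
    [&& path (adj G) x p, last x p == y & uniq (x :: p)]].

(* [None] stands for the infinite distance, when no path exists. *)
Definition shortest_path (x y : V) : option nat :=
  match pselect (exists k, path_of_length x y k) with
  | left ex_path => Some (ex_minn ex_path)
  | right _ => None
  end.

End ShortestPath.

Section PseudoInverse.
Variable R : realType.

(* The four Penrose equations; transpose is the adjoint for real matrices.
   [pinvmx] of mxalgebra only satisfies some of them. *)
Definition is_pseudo_inverse m n (A : 'M[R]_(m, n)) (B : 'M[R]_(n, m)) : Prop :=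
  [/\ A *m B *m A = A, B *m A *m B = B,
      (A *m B)^T = A *m B & (B *m A)^T = B *m A].

Definition pseudo_inverse m n (A : 'M[R]_(m, n)) : 'M[R]_(n, m) :=
  xget 0 [set B | is_pseudo_inverse A B].

Lemma is_pseudo_inverse_unique m n (A : 'M[R]_(m, n)) (B C : 'M[R]_(n, m)) :
  is_pseudo_inverse A B -> is_pseudo_inverse A C -> B = C.
Proof.
move=> [ABA BAB sAB sBA] [ACA CAC sAC sCA].
have eAB : A *m B = A *m C.
  rewrite -[LHS]sAB -[in LHS]ACA -(mulmxA (A *m C)) trmx_mul sAB sAC.
  by rewrite mulmxA ABA.
have eBA : B *m A = C *m A.
  rewrite -[LHS]sBA -[in LHS]ACA !mulmxA -(mulmxA (B *m A)) trmx_mul sBA sCA.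
  by rewrite -mulmxA (mulmxA A) ABA.
by rewrite -BAB -mulmxA eAB mulmxA eBA CAC.
Qed.

Lemma unitmx_gram m n (A : 'M[R]_(m, n)) : row_free A -> A *m A^T \in unitmx.
Proof.
move=> Afree; rewrite -row_free_unit; apply: inj_row_free => v vAA0.
have /matrixP/(_ 0 0) : (v *m A) *m (v *m A)^T = 0.
  by rewrite trmx_mul mulmxA -(mulmxA v) vAA0 mul0mx.
rewrite mxE [RHS]mxE => /eqP; rewrite psumr_eq0; last first.
  by move=> i _; rewrite [_^T _ _]mxE -expr2 sqr_ge0.
move=> /allP vA0; apply: (row_free_inj Afree); rewrite mul0mx.
apply/rowP => j; rewrite [RHS]mxE.
have := vA0 j (mem_index_enum j).
by rewrite /= [_^T _ _]mxE -expr2 sqrf_eq0 => /eqP.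
Qed.

Lemma pseudo_inverseP m n (A : 'M[R]_(m, n)) :
  is_pseudo_inverse A (pseudo_inverse A).
Proof.
apply: (@xgetPex _ 0 [set B | is_pseudo_inverse A B]).
have [r [C [F [-> Cfull Ffree]]]] : exists r (C : 'M[R]_(m, r)) (F : 'M[R]_(r, n)),
    [/\ A = C *m F, row_full C & row_free F].
  exists (\rank A), (col_base A), (row_base A).
  by rewrite mulmx_base col_base_full row_base_free.
have FU : F *m F^T \in unitmx by rewrite unitmx_gram.
have CU : C^T *m C \in unitmx.
  have := @unitmx_gram _ _ C^T; rewrite trmxK; apply.
  by rewrite /row_free mxrank_tr.
pose P := F^T *m invmx (F *m F^T); pose Q := invmx (C^T *m C) *m C^T.
have FP : F *m P = 1%:M by rewrite /P mulmxA mulmxV.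
have QC : Q *m C = 1%:M by rewrite /Q -mulmxA mulVmx.
exists (P *m Q).
have AB : C *m F *m (P *m Q) = C *m Q by rewrite -mulmxA (mulmxA F) FP mul1mx.
have BA : P *m Q *m (C *m F) = P *m F by rewrite -mulmxA (mulmxA Q) QC mul1mx.
split => /=.
- by rewrite AB -mulmxA (mulmxA Q) QC mul1mx.
- by rewrite BA -mulmxA (mulmxA F) FP mul1mx.
- by rewrite AB /Q !trmx_mul trmx_inv trmx_mul !trmxK mulmxA.
- by rewrite BA /P !trmx_mul trmx_inv trmx_mul !trmxK mulmxA.
Qed.

End PseudoInverse.

Section EffectiveResistance.
Variables (R : realType) (n : nat) (G : sgraph 'I_n).

Definition adjacency : 'M[R]_n := \matrix_(i, j) (adj G i j)%:R.

Definition degree (i : 'I_n) : nat := #|[pred j | adj G i j]|.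

Definition laplacian : 'M[R]_n :=
  diag_mx (\row_i (degree i)%:R) - adjacency.

Definition indicator (x : 'I_n) : 'cV[R]_n := delta_mx x 0.

Definition effective_resistance (x y : 'I_n) : R :=
  ((indicator x - indicator y)^T *m pseudo_inverse laplacian
     *m (indicator x - indicator y)) 0 0.

End EffectiveResistance.

(* Deterministic adaptive query algorithms: decision trees whose nodes query a
   pair of elements of [V] and branch on the answer. *)
Inductive query_algorithm (V Answer Output : Type) : Type :=
| Return of Output
| Query of V & V & (Answer -> query_algorithm V Answer Output).

Section Run.
Variables (V Answer Output : Type) (oracle : V -> V -> Answer).

Fixpoint run (A : query_algorithm V Answer Output) : Output :=
  match A with
  | Return b => b
  | Query x y next => run (next (oracle x y))
  end.

Fixpoint num_queries (A : query_algorithm V Answer Output) : nat :=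
  match A with
  | Return _ => 0
  | Query x y next => (num_queries (next (oracle x y))).+1
  end.

End Run.

Section ResistanceTesters.
Variables (R : realType) (n : nat) (u v : 'I_n).

Definition resistance_tests_adjacency (A : query_algorithm 'I_n R bool) : Prop :=
  forall G : sgraph 'I_n, run (effective_resistance R G) A = adj G u v.

(* A randomized algorithm is a random decision tree; on every graph its answer
   must be correct with probability at least 2/3. *)
Definition resistance_tests_adjacency_whp (d : measure_display)
    (T : measurableType d) (P : probability T R)
    (A : T -> query_algorithm 'I_n R bool) : Prop :=
  forall G : sgraph 'I_n,
    let correct := [set w | run (effective_resistance R G) (A w) = adj G u v] in
    measurable correct /\ ((2 / 3)%:E <= P correct)%E.

End ResistanceTesters.

(* Main.v *)
(** Adjacency is distance one, so one shortest path query decides it.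

    For the lower bound, compare the star centred at [u] with the graphs
    obtained from it by replacing the edge [uv] by the two paths [u a v] and
    [u b v].  Two paths of length two in parallel have resistance one, so every
    resistance between vertices other than [a] and [b] is unchanged.  Take about
    [n / 2] disjoint pairs [{a, b}]: each query meets at most two of them, so an
    algorithm making [q] queries on the star tells it apart from at most [2 q] of
    the modified graphs.  In the randomized case, summing over the pairs the
    probability (at least 1/3) of being correct on both graphs gives the same
    bound up to a factor 3. *)

Require Import Defs.
From mathcomp Require Import measurable_realfun zify ring lra.
Import Order.TTheory GRing.Theory Num.Theory.

Set Implicit Arguments.
Unset Strict Implicit.
Unset Printing Implicit Defensive.

Local Open Scope ring_scope.

(** * Adjacency and distance one *)

(** A path of length zero forces [x = y], which irreflexivity excludes for adjacent vertices; so an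
    edge makes the minimal length exactly one. *)
Lemma shortest_path_eq1 (V : finType) (G : sgraph V) (x y : V) :
  (shortest_path G x y == Some 1%N) = adj G x y.
Proof.
have len0 : path_of_length G x y 0 = (x == y).
  apply/existsP/eqP => [[p]|<-]; last by exists [tuple]; rewrite /= eqxx.
  by rewrite tuple0 /= andbT => /eqP.
have len1 : path_of_length G x y 1 = adj G x y.
  apply/existsP/idP => [[[[|z []] //= ?]]|xy].
    by rewrite andbT => /and3P[xz /eqP<-].
  exists [tuple y]; rewrite /= xy eqxx inE !andbT /=.
  by apply: contraTneq xy => ->; rewrite adj_irr.
rewrite /shortest_path; case: pselect => [ex_path|no_path]; last first.
  by apply/esym/negP => xy; apply: no_path; exists 1%N; rewrite len1.
case: ex_minnP => k xyk k_min; apply/eqP/idP => [[k1]|xy].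
  by rewrite -len1 -k1.
have : (k <= 1)%N by apply: k_min; rewrite len1.
case: k xyk {k_min} => [|[|]] //; rewrite len0 => /eqP xEy.
by rewrite xEy adj_irr in xy.
Qed.

(** * Effective resistance as a potential difference *)

Section Potentials.
Variables (R : realType) (n : nat) (G : sgraph 'I_n).

Lemma laplacian_mulmxE (z : 'I_n -> R) i :
  (laplacian R G *m \col_j z j) i 0 = \sum_j (adj G i j)%:R * (z i - z j).
Proof.
rewrite mulmxBl mul_diag_mx !mxE; under eq_bigr do rewrite !mxE.
under [RHS]eq_bigr do rewrite mulrBr.
rewrite sumrB; congr (_ - _); rewrite -mulr_suml; congr (_ * _).
by rewrite -natr_sum /degree -sum1_card big_mkcond.
Qed.

Lemma laplacian_sym : (laplacian R G)^T = laplacian R G.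
Proof.
rewrite /laplacian linearB /= tr_diag_mx; congr (_ - _).
by apply/matrixP => i j; rewrite !mxE adj_sym.
Qed.

(** Exchanging the two summation indices negates the double sum, since adjacency is symmetric and
    [z i - z j] antisymmetric. *)
Lemma sum_laplacian_mulmx (z : 'I_n -> R) :
  \sum_i (laplacian R G *m \col_j z j) i 0 = 0.
Proof.
under eq_bigr do rewrite laplacian_mulmxE; set S := (LHS).
have : S = - S.
  rewrite {1}/S exchange_big /= -sumrN; apply: eq_bigr => i _.
  rewrite -sumrN; apply: eq_bigr => j _.
  by rewrite adj_sym -mulrN opprB.
by move/eqP; rewrite -subr_eq0 opprK -mulr2n mulrn_eq0 => /eqP.
Qed.

(** By symmetry of the Laplacian [L] and the first Penrose equation, the quadratic form at [L z] is
    [z^T L z]. Any solution [z] serves, so the pseudoinverse is never computed. *)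
Lemma effective_resistance_mulmx (z : 'cV[R]_n) x y :
  laplacian R G *m z = indicator R x - indicator R y ->
  effective_resistance R G x y = z x 0 - z y 0.
Proof.
move=> Lz; have [LPL _ _ _] := pseudo_inverseP (laplacian R G).
rewrite /effective_resistance -Lz trmx_mul laplacian_sym -!mulmxA.
rewrite (mulmxA (laplacian _ _)) (mulmxA (_ *m _)) LPL Lz.
rewrite mulmxBr mxE [X in _ + X]mxE /indicator -!colE.
by rewrite !mxE.
Qed.

(* The equation at [r] is redundant: both sides sum to zero over all rows. *)
Lemma effective_resistance_potential (r : 'I_n) (z : 'I_n -> R) x y :
  (forall i, i != r ->
     \sum_j (adj G i j)%:R * (z i - z j) = (i == x)%:R - (i == y)%:R) ->
  effective_resistance R G x y = z x - z y.
Proof.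
move=> zP; rewrite (effective_resistance_mulmx (z := \col_j z j)) ?mxE //.
have off_r i : i != r ->
    (laplacian R G *m \col_j z j) i 0 = (i == x)%:R - (i == y)%:R.
  by move=> ir; rewrite laplacian_mulmxE zP.
have sum_delta (t : 'I_n) : \sum_i (i == t)%:R = 1 :> R.
  by rewrite (bigD1 t) //= eqxx big1 ?addr0 // => i /negPf->.
apply/colP => i; rewrite !mxE eqxx !andbT.
have [-> {i}|/off_r] := eqVneq i r; last by rewrite mxE.
have := sum_laplacian_mulmx z; rewrite (bigD1 r) //= (eq_bigr _ off_r).
have : \sum_i ((i == x)%:R - (i == y)%:R) = 0 :> R.
  by rewrite sumrB !sum_delta subrr.
rewrite (bigD1 r) //= => sumb sumL.
by have /addIr := etrans sumL (esym sumb); rewrite mxE.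
Qed.

End Potentials.

(** * The star and its modifications *)

Section HardGraphs.
Variables (R : realType) (n : nat).
Implicit Types (e : rel 'I_n) (u v a b x y : 'I_n).

Definition sym_closure_rel e : rel 'I_n :=
  fun i j => (i != j) && (e i j || e j i).

Lemma sym_closure_rel_sym e : symmetric (sym_closure_rel e).
Proof. by move=> i j; rewrite /sym_closure_rel eq_sym orbC. Qed.

Lemma sym_closure_rel_irr e : irreflexive (sym_closure_rel e).
Proof. by move=> i; rewrite /sym_closure_rel eqxx. Qed.

Definition sym_closure e : sgraph 'I_n :=
  SGraph (@sym_closure_rel_sym e) (@sym_closure_rel_irr e).

Definition star u : sgraph 'I_n := sym_closure (fun i _ => i == u).

Definition split_star u v a b : sgraph 'I_n :=
  sym_closure (fun i j => (i == u) && (j != v) ||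
                          (i == v) && ((j == a) || (j == b))).

Lemma adj_star u v : u != v -> adj (star u) u v.
Proof. by move=> uv; rewrite /= /sym_closure_rel uv eqxx. Qed.

Lemma adj_split_star u v a b :
  a != u -> b != u -> adj (split_star u v a b) u v = false.
Proof.
move=> /negPf au /negPf bu; rewrite /= /sym_closure_rel !eqxx.
by rewrite (eq_sym u a) (eq_sym u b) au bu (eq_sym v u); case: (u == v).
Qed.

Lemma sum_delta_mull (F : 'I_n -> R) t : \sum_j (j == t)%:R * F j = F t.
Proof.
rewrite (bigD1 t) //= eqxx mul1r big1 ?addr0 // => j /negPf->.
by rewrite mul0r.
Qed.

Lemma effective_resistance_star u x y :
  effective_resistance R (star u) x y =
  (x != u)%:R * (1 - (x == y)%:R) - (y != u)%:R * ((y == x)%:R - 1).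
Proof.
(* Grounded at [u]: the only edge at a leaf goes to [u], so the potential of the leaf equals the
   current injected there. *)
pose z i : R := (i != u)%:R * ((i == x)%:R - (i == y)%:R).
rewrite (@effective_resistance_potential _ _ _ u z) => [|i iu].
  by rewrite /z !eqxx.
rewrite (eq_bigr (fun j => (j == u)%:R * (z i - z j))) => [|j _].
  by rewrite sum_delta_mull /z iu eqxx mul0r subr0 mul1r.
congr (_%:R * _); rewrite /= /sym_closure_rel (negPf iu) /=.
by case: (eqVneq j u) => [->|_]; rewrite ?iu ?andbF.
Qed.

Lemma effective_resistance_split_star u v a b x y :
  u != v -> a != b -> a != u -> a != v -> b != u -> b != v ->
  x != a -> x != b -> y != a -> y != b ->
  effective_resistance R (split_star u v a b) x y =
  effective_resistance R (star u) x y.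
Proof.
move=> uv ab au av bu bv xa xb ya yb.
pose z i : R := (i != u)%:R * ((i == x)%:R - (i == y)%:R).
(* The star potential, except that [a] and [b] lie halfway between [0] at [u] and [z v] at [v]. The
   two edges at [v] then carry [z v / 2] each, together the current of the removed edge. *)
pose z' i : R := if (i == a) || (i == b) then z v / 2 else z i.
have z'E i : i != a -> i != b -> z' i = z i.
  by rewrite /z' => /negPf-> /negPf->.
rewrite effective_resistance_star.
rewrite (@effective_resistance_potential _ _ _ u z') => [|i iu].
  by rewrite !z'E // /z !eqxx.
have zu : z' u = 0 by rewrite z'E 1?eq_sym // /z eqxx mul0r.
have zv : z' v = z v by rewrite z'E 1?eq_sym.
have zE j : j != u -> z j = (j == x)%:R - (j == y)%:R.
  by rewrite /z => ->; rewrite mul1r.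
have za : z' a = z v / 2 by rewrite /z' eqxx.
have zb : z' b = z v / 2 by rewrite /z' eqxx orbT.
rewrite -zE //.
have [-> {i iu}|iv] := eqVneq i v.
  rewrite (eq_bigr (fun j => (j == a)%:R * (z' v - z' j) +
                             (j == b)%:R * (z' v - z' j))) => [|j _].
    by rewrite big_split /= !sum_delta_mull za zb zv; field.
  rewrite -mulrDl -natrD; congr (_%:R * _).
  rewrite /= /sym_closure_rel !eqxx [v == u]eq_sym [v == j]eq_sym (negPf uv) /=.
  have [->|jv] := eqVneq j v; first by rewrite !(eq_sym v) (negPf av) (negPf bv).
  rewrite andbF /= orbF; have [->|ja] := eqVneq j a; first by rewrite (negPf ab).
  by case: (j == b).
(* No current is injected at [a] or [b], as neither is [x] or [y]; the midpoint value balances the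
   two edges there. *)
have row_ab : (i == a) || (i == b) ->
    \sum_j (adj (split_star u v a b) i j)%:R * (z' i - z' j) = z i.
  move=> iab; have -> : z i = 0.
    rewrite zE //; case/orP: iab => /eqP->.
      by rewrite ![a == _]eq_sym (negPf xa) (negPf ya) subrr.
    by rewrite ![b == _]eq_sym (negPf xb) (negPf yb) subrr.
  rewrite (eq_bigr (fun j => (j == u)%:R * (z' i - z' j) +
                             (j == v)%:R * (z' i - z' j))) => [|j _].
    by rewrite big_split /= !sum_delta_mull zu zv /z' iab; field.
  rewrite -mulrDl -natrD; congr (_%:R * _).
  rewrite /= /sym_closure_rel (negPf iu) (negPf iv) iab !andbT /=.
  have [->|ju] := eqVneq j u; first by rewrite iu (negPf uv).
  by have [->|jv] := eqVneq j v; rewrite ?iv ?andbF.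
have [/row_ab //|iab] := boolP ((i == a) || (i == b)).
rewrite (eq_bigr (fun j => (j == u)%:R * (z' i - z' j))) => [|j _].
  by rewrite sum_delta_mull zu subr0 z'E //; apply: contra iab => ->;
    rewrite ?orbT.
congr (_%:R * _).
rewrite /= /sym_closure_rel (negPf iu) (negPf iv) (negPf iab) !andbF /= orbF andbT.
by have [->|ju] := eqVneq j u; rewrite ?iu ?andbF.
Qed.

End HardGraphs.

(** * Counting tools *)

(** A union bound along the branch that [oracle] follows: a run with another output must get a
    different answer at some node of this branch. *)
Lemma card_run_neq (V : Type) (Answer Output : eqType) (I : finType) (k : nat)
    (oracle : V -> V -> Answer) (oracles : I -> V -> V -> Answer)
    (A : query_algorithm V Answer Output) :
  (forall x y, #|[pred i | oracles i x y != oracle x y]| <= k)%N ->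
  (#|[pred i | run (oracles i) A != run oracle A]|
     <= k * num_queries oracle A)%N.
Proof.
move=> query_le; elim: A => [b|x y next IH] /=.
  by rewrite eq_card0 // => i; rewrite !inE eqxx.
rewrite mulnS; apply: leq_trans (leq_add (query_le x y) (IH (oracle x y))).
rewrite -cardUI; apply: leq_trans (leq_addr _ _).
apply/subset_leq_card/fintype.subsetP => i; rewrite !inE.
by have [->|] := eqVneq (oracles i x y) (oracle x y).
Qed.

(** Pair [i] is [f (i, true)], [f (i, false)]; injectivity on the product gives both distinct ends
    and disjoint pairs. *)
Lemma exists_disjoint_pairs (n m : nat) (u v : 'I_n) : (m.*2 + 2 <= n)%N ->
  exists2 f : 'I_m * bool -> 'I_n,
    injective f & forall p, f p != u /\ f p != v.
Proof.
move=> mn; pose S := [pred x | (x != u) && (x != v)].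
have le_S : (#|{: 'I_m * bool}| <= #|S|)%N.
  rewrite card_prod card_ord card_bool muln2.
  have := cardC S; rewrite card_ord.
  have : (#|[predC S]| <= 2)%N.
    rewrite (leq_trans _ (card_size [:: u; v])) //; apply: subset_leq_card.
    by apply/fintype.subsetP => x; rewrite !inE negb_and !negbK.
  by move: (#|[predC S]|) (#|S|) => c d; lia.
exists (fun p => enum_val (widen_ord le_S (enum_rank p))) => [p q|p].
  by move=> /enum_val_inj[pq]; apply/enum_rank_inj/ord_inj.
by apply/andP; have := enum_valP (widen_ord le_S (enum_rank p)).
Qed.

(** The sum is the expected number of events that occur, and this number is at most [k] at every
    outcome. *)
Lemma sum_probability_le (R : realType) (d : measure_display)
    (T : measurableType d) (P : probability T R) (I : finType)
    (C : I -> set T) (k : R) :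
  (forall i, measurable (C i)) ->
  (forall w, \sum_i (w \in C i)%:R <= k) ->
  (\sum_i P (C i) <= k%:E)%E.
Proof.
move=> mC Ck.
have k0 : 0 <= k by apply: le_trans (Ck point); apply: sumr_ge0.
rewrite (eq_bigr (fun i => \int[P]_w (\1_(C i) w)%:E)%E) => [|i _]; last first.
  by rewrite integral_indic // setIT.
rewrite -ge0_integral_sum // => [|i]; last first.
  by apply/measurable_EFinP/measurable_indic.
have -> : (k%:E = \int[P]_w k%:E)%E.
  by rewrite integral_cst // [X in (_ * X)%E](probability_setT P) mule1.
apply: ge0_le_integral => // [w _||w _].
- by apply: sume_ge0 => i _; rewrite lee_fin.
- by apply: emeasurable_sum => i; apply/measurable_EFinP/measurable_indic.
- by rewrite sumEFin lee_fin; under eq_bigr do rewrite indicE.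
Qed.

(** * Query lower bounds *)

Section LowerBound.
Variables (R : realType) (n m : nat) (u v : 'I_n).
Variable f : 'I_m * bool -> 'I_n.
Hypotheses (uv : u != v) (f_inj : injective f).
Hypothesis f_uv : forall p, f p != u /\ f p != v.

Let G0 := star u.
Let G i := split_star u v (f (i, true)) (f (i, false)).

Lemma card_resistance_neq x y :
  (#|[pred i | effective_resistance R (G i) x y !=
               effective_resistance R G0 x y]| <= 2)%N.
Proof.
pose touch z := [pred i : 'I_m | (z == f (i, true)) || (z == f (i, false))].
have touch_le1 z : (#|touch z| <= 1)%N.
  apply/card_le1_eqP => i j; rewrite !inE.
  by move=> /orP[]/eqP-> /orP[]/eqP/f_inj[].
apply: leq_trans (leq_add (touch_le1 x) (touch_le1 y)).
rewrite -cardUI; apply: leq_trans (leq_addr _ _).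
apply/subset_leq_card/fintype.subsetP => i; rewrite !inE.
apply: contraR; rewrite !negb_or -!andbA => /and4P[xa xb ya yb].
have [[au av] [bu bv]] := (f_uv (i, true), f_uv (i, false)).
apply/eqP/effective_resistance_split_star => //.
by apply/eqP => /f_inj.
Qed.

(** Being right on both graphs requires different outputs, since [uv] is an edge of the star only.
    Correctness is assumed on the star alone, so that the bound applies to each outcome of a
    randomized algorithm. *)
Lemma card_correct_le (A : query_algorithm 'I_n R bool) :
  run (effective_resistance R G0) A = adj G0 u v ->
  (#|[pred i | run (effective_resistance R (G i)) A == adj (G i) u v]|
     <= 2 * num_queries (effective_resistance R G0) A)%N.
Proof.
move=> correct0; apply: leq_trans (card_run_neq _ card_resistance_neq).
apply/subset_leq_card/fintype.subsetP => i; rewrite !inE => /eqP->.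
by rewrite correct0 adj_star // adj_split_star // (f_uv _).1.
Qed.

Lemma deterministic_lower_bound (A : query_algorithm 'I_n R bool) :
  resistance_tests_adjacency u v A ->
  (m <= 2 * num_queries (effective_resistance R G0) A)%N.
Proof.
move=> Atest; rewrite -[X in (X <= _)%N](card_ord m).
apply: leq_trans (card_correct_le (Atest G0)).
by apply/subset_leq_card/fintype.subsetP => i _; rewrite inE Atest.
Qed.

Lemma randomized_lower_bound (d : measure_display) (T : measurableType d)
    (P : probability T R) (A : T -> query_algorithm 'I_n R bool) (q : R) :
  resistance_tests_adjacency_whp u v P A -> 0 <= q ->
  (forall w, (num_queries (effective_resistance R G0) (A w))%:R <= q) ->
  m%:R / 3 <= 2 * q.
Proof.
move=> Atest q0 Aq.
pose C H := [set w | run (effective_resistance R H) (A w) = adj H u v]%classic.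
have mC H : measurable (C H) by have [] := Atest H.
have PC H : ((2 / 3)%:E <= P (C H))%E by have [] := Atest H.
pose D i := (C G0 `&` C (G i))%classic.
have mD i : measurable (D i) by exact: measurableI.
have PE S : measurable S -> P S = (fine (P S))%:E.
  by move=> mS; rewrite fineK // fin_num_measure.
(* The failure probability on the star is at most 1/3, which leaves at least 2/3 - 1/3 for success
   on both graphs. *)
have PD i : ((1 / 3)%:E <= P (D i))%E.
  have : (P (C (G i)) <= P (D i) + P (~` C G0)%classic)%E.
    apply: le_trans (measureU2 _ (mD i) (measurableC (mC _))).
    apply: le_measure; rewrite ?inE //.
      by apply: measurableU => //; exact: measurableC.
    by move=> w Ciw; have [C0w|] := pselect (C G0 w); [left|right].
  rewrite probability_setC // => /(le_trans (PC (G i))); move: (PC G0).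
  rewrite (PE _ (mC G0)) (PE _ (mD i)) -EFinB -EFinD !lee_fin; lra.
have : (\sum_i P (D i) <= (2 * q)%:E)%E.
  apply: sum_probability_le => // w.
  (* An outcome that errs on the star lies in no [D i]; for any other, the count of correct [G i] is
     bounded. *)
  have [C0w|C0w] := pselect (C G0 w); last first.
    rewrite big1 ?mulr_ge0 // => i _; case: (boolP (w \in _)) => //.
    by rewrite inE => -[].
  apply: le_trans (ler_wpM2l _ (Aq w)) => //; rewrite -natrM -natr_sum ler_nat.
  apply: leq_trans (card_correct_le C0w); rewrite -sum1_card [leqRHS]big_mkcond /=.
  apply: leq_sum => i _; rewrite !inE; case: (boolP (w \in _)) => //.
  by rewrite inE => -[_ /= ->]; rewrite eqxx.
rewrite -[m%:R / 3 <= _]lee_fin; apply: le_trans.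
have -> : ((m%:R / 3)%:E = \sum_(i < m) (1 / 3)%:E :> \bar R)%E.
  by rewrite sumEFin sumr_const card_ord mul1r mulr_natl.
by apply: lee_sum => i _.
Qed.

End LowerBound.

Theorem mainTheorem9 (R : realType) :
  (exists A : forall n : nat,
                'I_n -> 'I_n -> query_algorithm 'I_n (option nat) bool,
     forall (n : nat) (u v : 'I_n) (G : sgraph 'I_n),
       run (shortest_path G) (A n u v) = adj G u v /\
       num_queries (shortest_path G) (A n u v) = 1%N) /\
  (exists (c : R) (N : nat), 0 < c /\
     forall n : nat, (N <= n)%N -> forall u v : 'I_n, u != v ->
       (forall A : query_algorithm 'I_n R bool,
          resistance_tests_adjacency u v A ->
          exists G : sgraph 'I_n,
            c * n%:R <= (num_queries (effective_resistance R G) A)%:R) /\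
       (forall (d : measure_display) (T : measurableType d)
               (P : probability T R) (A : T -> query_algorithm 'I_n R bool),
          resistance_tests_adjacency_whp u v P A ->
          exists (w : T) (G : sgraph 'I_n),
            c * n%:R <= (num_queries (effective_resistance R G) (A w))%:R)).

Proof.
split.
  exists (fun n u v => Query u v (fun d => Return _ _ (d == Some 1%N))).
  by move=> n u v G; split => //=; exact: shortest_path_eq1.
(* From [n <= 2 m + 3] and [n >= 7] follows [n < 4 m]. Fewer than [n / 24] queries in every run
   would give [m / 3 <= n / 12], a contradiction; the deterministic bound [m / 2] exceeds
   [n / 8]. *)
exists (1 / 24), 7%N; split; first by lra.
move=> n n7 u v uv; pose m := ((n - 2) %/ 2)%N.
have mn : (m.*2 + 2 <= n)%N by rewrite /m; lia.
have nm : n%:R < 4 * m%:R :> R.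
  by rewrite -natrM ltr_nat /m; lia.
have n0 : 0 <= n%:R :> R by exact: ler0n.
have [f f_inj f_uv] := exists_disjoint_pairs u v mn.
split=> [A Atest|d T P A Atest].
  exists (star u); have := deterministic_lower_bound uv f_inj f_uv Atest.
  by rewrite -(ler_nat R) natrM; lra.
apply: contrapT => few.
have : m%:R / 3 <= 2 * (1 / 24 * n%:R) :> R.
  apply: (randomized_lower_bound uv f_inj f_uv Atest) => [|w].
    by rewrite mulr_ge0.
  by rewrite leNgt; apply/negP => /ltW wq; apply: few; exists w, (star u).
lra.
Qed.
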